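(* Let $(\mathcal{T},\mathcal{F})=(\mathcal{C},\mathcal{T},\mathcal{F},t,\varepsilon,f,\eta)$ be a near-torsion theory in a category $\mathcal{C}$. Let $\mathring{\mathcal{T}}$, $\mathring{\mathcal{F}}$, and $\mathcal{C}_{\mathcal{T},\mathcal{F}}$ be the full subcategories of $\mathcal{T}$, $\mathcal{F}$ and $\mathcal{C}$, respectively, defined as follows: (a) $T\in\mathring{\mathcal{T}}$ if and only if $T\in\mathcal{T}$ and $\eta_T:T\to f(T)$ is an epimorphism in $\mathcal{C}$; (b) $F\in\mathring{\mathcal{F}}$ if and only if $F\in\mathcal{F}$ and $\varepsilon_F:t(F)\to F$ is a monomorphism in $\mathcal{C}$; (c) $B\in\mathcal{C}_{\mathcal{T},\mathcal{F}}$ if and only if $t(B)\in\mathring{\mathcal{T}}$, $f(B)\in\mathring{\mathcal{F}}$, the commutative square $\eta_B\,\varepsilon_B=\varepsilon_{f(B)}\,t(\eta_B)$ (with vertices $t(B)$, $tf(B)$, $B$, $f(B)$) is a pullback in $\mathcal{C}$, and the commutative square $\eta_B\,\varepsilon_B=f(\varepsilon_B)\,\eta_{t(B)}$ (with vertices $t(B)$, $ft(B)$, $B$, $f(B)$) is a pushout in $\mathcal{C}$. Then $(\mathring{\mathcal{T}},\mathring{\mathcal{F}})$ is a (non-pointed) torsion theory in $\mathcal{C}_{\mathcal{T},\mathcal{F}}$. Moreover, $\mathring{\mathcal{T}}=\mathcal{T}\cap\mathcal{C}_{\mathcal{T},\mathcal{F}}$, $\mathring{\mathcal{F}}=\mathcal{F}\cap\mathcal{C}_{\mathcal{T},\mathcal{F}}$,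 and $\mathcal{C}_{\mathcal{T},\mathcal{F}}$ is the largest full subcategory $\mathcal{C}'$ of $\mathcal{C}$ such that every object $B$ of $\mathcal{C}'$ satisfies the torsion conditions (TT1) and (TT2) stated in the context, with the monomorphisms, epimorphisms, pullbacks, and pushouts involved being as in $\mathcal{C}$.
   Context: A near-torsion theory in a category $\mathcal{C}$ is a pair $(\mathcal{T},\mathcal{F})$ of full replete (closed under isomorphism) subcategories of $\mathcal{C}$ such that: (1) $\mathcal{T}$ is coreflective: the inclusion $\mathcal{T}\to\mathcal{C}$ has a right adjoint $t:\mathcal{C}\to\mathcal{T}$ which is a left inverse of the inclusion; the counit is $\varepsilon$, with components $\varepsilon_A:t(A)\to A$, and the unit is the identity; (2) $\mathcal{F}$ is reflective: the inclusion $\mathcal{F}\to\mathcal{C}$ has a left adjoint $f:\mathcal{C}\to\mathcal{F}$ which is a left inverse of the inclusion; the unit is $\eta$, with components $\eta_A:A\to f(A)$, and the counit is the identity; (3) $A\in\mathcal{F}\Rightarrow t(A)\in\mathcal{F}$; (4) $A\in\mathcal{T}\Rightarrow f(A)\in\mathcal{T}$. All these data are denoted $(\mathcal{C},\mathcal{T},\mathcal{F},t,\varepsilon,f,\eta)$. One has $T\in\mathcal{T}\Leftrightarrow\varepsilon_T=1_T$ and $F\in\mathcal{F}\Leftrightarrow\eta_F=1_F$. Torsion conditions on an object $B$: (TT1) $\varepsilon_{f(B)}:tf(B)\to f(B)$ is a monomorphism, and the square $\eta_B\varepsilon_B=\varepsilon_{f(B)}t(\eta_B)$ is a pullback (of $\eta_B$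 along $\varepsilon_{f(B)}$); (TT2) $\eta_{t(B)}:t(B)\to ft(B)$ is an epimorphism, and the square $\eta_B\varepsilon_B=f(\varepsilon_B)\eta_{t(B)}$ is a pushout (of $\varepsilon_B$ along $\eta_{t(B)}$). A near-torsion theory in a category is a (non-pointed) torsion theory in that category (also called a pretorsion theory in the literature) if every object $B$ of that category satisfies (TT1) and (TT2). Equivalently, for every object $B$, $\varepsilon_B$ is a $(\mathcal{T}\cap\mathcal{F})$-kernel of $\eta_B$ and $\eta_B$ is a $(\mathcal{T}\cap\mathcal{F})$-cokernel of $\varepsilon_B$, where kernels and cokernels are taken with respect to the ideal of morphisms that factor through an object of $\mathcal{T}\cap\mathcal{F}$, and the monomorphism and epimorphism requirements of (TT1) and (TT2) hold. *)

(* Defs.v *)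
Set Implicit Arguments.
Unset Strict Implicit.
Unset Printing Implicit Defensive.

Declare Scope cat_scope.
Delimit Scope cat_scope with cat.
Reserved Notation "g ∘ f" (at level 40, left associativity).

Record category := Category {
  obj :> Type;
  hom : obj -> obj -> Type;
  idm : forall A, hom A A;
  comp : forall A B D, hom B D -> hom A B -> hom A D;
  comp_idl : forall A B (f : hom A B), comp (idm B) f = f;
  comp_idr : forall A B (f : hom A B), comp f (idm A) = f;
  comp_assoc : forall A B D E (h : hom D E) (g : hom B D) (f : hom A B),
    comp h (comp g f) = comp (comp h g) f
}.

Arguments hom {c} A B.
Arguments idm {c} A.
Arguments comp {c A B D} g f.

Notation "g ∘ f" := (comp g f) : cat_scope.
Local Open Scope cat_scope.

Definition mono (C : category) (A B : C) (m : hom A B) : Prop :=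
  forall (X : C) (u v : hom X A), m ∘ u = m ∘ v -> u = v.

Definition epi (C : category) (A B : C) (e : hom A B) : Prop :=
  forall (X : C) (u v : hom B X), u ∘ e = v ∘ e -> u = v.

Definition isomorphic (C : category) (A B : C) : Prop :=
  exists (f : hom A B) (g : hom B A), g ∘ f = idm A /\ f ∘ g = idm B.

(* <<
     P --q--> Y
     |        |
     p        v
     |        |
     X --u--> Z
   >> *)
Definition is_pullback (C : category) (P X Y Z : C)
    (p : hom P X) (q : hom P Y) (u : hom X Z) (v : hom Y Z) : Prop :=
  u ∘ p = v ∘ q /\
  forall (W : C) (a : hom W X) (b : hom W Y), u ∘ a = v ∘ b ->
    exists! h : hom W P, p ∘ h = a /\ q ∘ h = b.

(* <<
     Z --v--> Y
     |        |
     u        q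
     |        |
     X --p--> Q
   >> *)
Definition is_pushout (C : category) (Z X Y Q : C)
    (u : hom Z X) (v : hom Z Y) (p : hom X Q) (q : hom Y Q) : Prop :=
  p ∘ u = q ∘ v /\
  forall (W : C) (a : hom X W) (b : hom Y W), a ∘ u = b ∘ v ->
    exists! h : hom Q W, h ∘ p = a /\ h ∘ q = b.

(* The identity morphism of A, seen as a morphism A -> B when A = B; this is
   how strict equations such as "the unit is the identity" are expressed. *)
Definition hom_of_eq (C : category) (A B : C) (e : A = B) : hom A B :=
  match e in _ = B' return hom A B' with eq_refl => idm A end.

Record functor (C D : category) := Functor {
  fobj :> C -> D;
  fmap : forall A B : C, hom A B -> hom (fobj A) (fobj B);
  fmap_id : forall A : C, fmap (idm A) = idm (fobj A);
  fmap_comp : forall (A B E : C) (g : hom B E) (f : hom A B),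
    fmap (g ∘ f) = fmap g ∘ fmap f
}.

Arguments fmap {C D} f {A B} _ : rename.

Definition functor_id (C : category) : functor C C :=
  @Functor C C (fun A => A) (fun A B f => f)
    (fun A => eq_refl) (fun A B E g f => eq_refl).

Definition functor_comp (C D E : category) (G : functor D E) (F : functor C D) :
  functor C E.
Proof.
refine (@Functor C E (fun A => G (F A)) (fun A B f => fmap G (fmap F f)) _ _).
- intros A. rewrite fmap_id. apply fmap_id.
- intros A B X g f. rewrite fmap_comp. apply fmap_comp.
Defined.

(* Equality of functors on objects and on morphisms. *)
Definition functor_eq (C D : category) (F G : functor C D) : Prop :=
  exists e : forall A : C, F A = G A,
  forall (A B : C) (f : hom A B),
    hom_of_eq (e B) ∘ fmap F f = fmap G f ∘ hom_of_eq (e A).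

Record nat_trans (C D : category) (F G : functor C D) := NatTrans {
  component :> forall A : C, hom (F A) (G A);
  naturality : forall (A B : C) (f : hom A B),
    component B ∘ fmap F f = fmap G f ∘ component A
}.

Definition is_identity (C D : category) (F G : functor C D)
    (u : nat_trans F G) : Prop :=
  exists e : forall A : C, F A = G A, forall A : C, u A = hom_of_eq (e A).

Record adjunction (C D : category) (L : functor C D) (R : functor D C) :=
Adjunction {
  adj_unit : nat_trans (functor_id C) (functor_comp R L);
  adj_counit : nat_trans (functor_comp L R) (functor_id D);
  adj_triangle_l : forall A : C,
    adj_counit (L A) ∘ fmap L (adj_unit A) = idm (L A);
  adj_triangle_r : forall B : D,
    fmap R (adj_counit B) ∘ adj_unit (R B) = idm (R B)
}.

(* A full subcategory is given by a predicate on objects. *)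
Definition full_subcat (C : category) : Type := C -> Prop.

Definition full_sub (C : category) (P : full_subcat C) : category :=
  @Category {A : C | P A}
    (fun A B => hom (proj1_sig A) (proj1_sig B))
    (fun A => idm (proj1_sig A))
    (fun A B D g f => g ∘ f)
    (fun A B f => comp_idl f)
    (fun A B f => comp_idr f)
    (fun A B D E h g f => comp_assoc h g f).

Definition inclusion (C : category) (P : full_subcat C) :
    functor (full_sub P) C :=
  @Functor (full_sub P) C (fun A => proj1_sig A) (fun A B f => f)
    (fun A => eq_refl) (fun A B E g f => eq_refl).

Definition replete (C : category) (P : full_subcat C) : Prop :=
  forall A B : C, isomorphic A B -> P A -> P B.

Definition is_largest (C : category) (Q : full_subcat C -> Prop)
    (P : full_subcat C) : Prop :=
  Q P /\ forall P' : full_subcat C, Q P' -> forall B : C, P' B -> P B.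

Record near_torsion_theory (C : category) (T F : full_subcat C) :=
NearTorsionTheory {
  T_replete : replete T;
  F_replete : replete F;
  coreflector : functor C (full_sub T);
  coreflection : adjunction (inclusion T) coreflector;
  coreflector_left_inverse :
    functor_eq (functor_comp coreflector (inclusion T)) (functor_id (full_sub T));
  coreflection_unit : is_identity (adj_unit coreflection);
  reflector : functor C (full_sub F);
  reflection : adjunction reflector (inclusion F);
  reflector_left_inverse :
    functor_eq (functor_comp reflector (inclusion F)) (functor_id (full_sub F));
  reflection_counit : is_identity (adj_counit reflection);
  coreflector_F : forall A : C, F A -> F (inclusion T (coreflector A));
  reflector_T : forall A : C, T A -> T (inclusion F (reflector A))
}.

Section NearTorsionTheory.
Variables (C : category) (T F : full_subcat C) (N : near_torsion_theory T F).

(* t and f as endofunctors of C *)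
Definition tt_t : functor C C := functor_comp (inclusion T) (coreflector N).
Definition tt_f : functor C C := functor_comp (inclusion F) (reflector N).

Definition tt_eps : nat_trans tt_t (functor_id C) := adj_counit (coreflection N).
Definition tt_eta : nat_trans (functor_id C) tt_f := adj_unit (reflection N).

Definition pullback_square (B : C) : Prop :=
  is_pullback (tt_eps B) (fmap tt_t (tt_eta B)) (tt_eta B) (tt_eps (tt_f B)).

Definition pushout_square (B : C) : Prop :=
  is_pushout (tt_eps B) (tt_eta (tt_t B)) (tt_eta B) (fmap tt_f (tt_eps B)).

Definition TT1 (B : C) : Prop := mono (tt_eps (tt_f B)) /\ pullback_square B.

Definition TT2 (B : C) : Prop := epi (tt_eta (tt_t B)) /\ pushout_square B.

Definition T_ring : full_subcat C := fun A => T A /\ epi (tt_eta A).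

Definition F_ring : full_subcat C := fun A => F A /\ mono (tt_eps A).

Definition C_TF : full_subcat C := fun B =>
  T_ring (tt_t B) /\ F_ring (tt_f B) /\ pullback_square B /\ pushout_square B.

End NearTorsionTheory.

(* The adjoints are determined by (T, F) up to isomorphism, and TT1 and TT2 do
   not depend on their choice. *)
Definition torsion_theory (C : category) (T F : full_subcat C) : Prop :=
  exists N : near_torsion_theory T F, forall B : C, TT1 N B /\ TT2 N B.

(* The objects of P', regarded as a full subcategory of the category given by P;
   this is P' itself as soon as P' is contained in P. *)
Definition sub_in (C : category) (P P' : full_subcat C) :
    full_subcat (full_sub P) :=
  fun A => P' (inclusion P A).

Arguments sub_in {C} P P' A.

(* Main.v *)
(** Since [ε] is invertible on [T] and [η] is invertible on [F], for an object of
    [T] whose [η] is epi both squares have a pair of opposite invertible sides;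
    hence it lies in [C_TF], and dually for [F].  Therefore [t] and [f] restrict
    to [C_TF], where they land in the two smaller subcategories, and monos, epis,
    pullbacks and pushouts of [C] between objects of a full subcategory are such
    in the subcategory as well. *)
Require Import Defs.
From Stdlib Require Import ProofIrrelevance.

Set Implicit Arguments.
Unset Strict Implicit.
Unset Printing Implicit Defensive.
Local Open Scope cat_scope.

(** * Isomorphisms, monos, epis, and squares with a pair of opposite invertible sides *)

Section Isomorphisms.
Variable C : category.

Definition is_iso (A B : C) (f : hom A B) : Prop :=
  exists g : hom B A, g ∘ f = idm A /\ f ∘ g = idm B.

Lemma is_iso_isomorphic (A B : C) (f : hom A B) : is_iso f -> isomorphic A B.
Proof. intros [g H]. exists f, g. exact H. Qed.

Lemma isomorphic_sym (A B : C) : isomorphic A B -> isomorphic B A.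
Proof. intros (f & g & H1 & H2). exists g, f. split; assumption. Qed.

Lemma hom_of_eq_iso (A B : C) (e : A = B) : is_iso (hom_of_eq e).
Proof. destruct e. exists (idm A). split; apply comp_idl. Qed.

Lemma iso_mono (A B : C) (f : hom A B) : is_iso f -> mono f.
Proof.
intros (g & Hgf & _) X u v E.
rewrite <- (comp_idl u), <- (comp_idl v), <- Hgf, <- !comp_assoc, E.
reflexivity.
Qed.

Lemma iso_epi (A B : C) (f : hom A B) : is_iso f -> epi f.
Proof.
intros (g & _ & Hfg) X u v E.
rewrite <- (comp_idr u), <- (comp_idr v), <- Hfg, !comp_assoc, E.
reflexivity.
Qed.

Lemma retraction_of_iso (A B : C) (r : hom B A) (s : hom A B) :
  is_iso s -> r ∘ s = idm A -> is_iso r.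
Proof.
intros (g & Hgs & Hsg) E. exists s. split; [|exact E].
rewrite <- Hsg. f_equal.
rewrite <- (comp_idr r), <- Hsg, comp_assoc, E. apply comp_idl.
Qed.

Lemma section_of_iso (A B : C) (r : hom B A) (s : hom A B) :
  is_iso r -> r ∘ s = idm A -> is_iso s.
Proof.
intros (g & Hgr & Hrg) E. exists r. split; [exact E|].
rewrite <- Hgr. f_equal.
rewrite <- (comp_idl s), <- Hgr, <- comp_assoc, E. apply comp_idr.
Qed.

Lemma mono_comp (A B D : C) (g : hom B D) (f : hom A B) :
  mono g -> mono f -> mono (g ∘ f).
Proof.
intros Hg Hf X u v E. apply Hf, Hg. rewrite !comp_assoc. exact E.
Qed.

Lemma epi_comp (A B D : C) (g : hom B D) (f : hom A B) :
  epi g -> epi f -> epi (g ∘ f).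
Proof.
intros Hg Hf X u v E. apply Hg, Hf. rewrite <- !comp_assoc. exact E.
Qed.

Lemma is_pullback_sym (P X Y Z : C)
    (p : hom P X) (q : hom P Y) (u : hom X Z) (v : hom Y Z) :
  is_pullback p q u v -> is_pullback q p v u.
Proof.
intros [E U]. split; [exact (eq_sym E)|]. intros W a b Eab.
destruct (U W b a (eq_sym Eab)) as [h [[H1 H2] H3]].
exists h. split; [split; assumption|].
intros k [K1 K2]. apply H3. split; assumption.
Qed.

Lemma is_pushout_sym (Z X Y Q : C)
    (u : hom Z X) (v : hom Z Y) (p : hom X Q) (q : hom Y Q) :
  is_pushout u v p q -> is_pushout v u q p.
Proof.
intros [E U]. split; [exact (eq_sym E)|]. intros W a b Eab.
destruct (U W b a (eq_sym Eab)) as [h [[H1 H2] H3]].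
exists h. split; [split; assumption|].
intros k [K1 K2]. apply H3. split; assumption.
Qed.

(** Inverting [p] forces the mediating map to be [p' ∘ a]; its equation with [b] holds after
    composing with [v], which can be cancelled. *)
Lemma pullback_of_isos (P X Y Z : C)
    (p : hom P X) (q : hom P Y) (u : hom X Z) (v : hom Y Z) :
  u ∘ p = v ∘ q -> is_iso p -> is_iso v -> is_pullback p q u v.
Proof.
intros E (p' & H1 & H2) Hv. split; [exact E|].
intros W a b Eab. exists (p' ∘ a). split; [split|].
- rewrite comp_assoc, H2. apply comp_idl.
- apply (iso_mono Hv).
  rewrite !comp_assoc, <- E, <- (comp_assoc u), H2, comp_idr. exact Eab.
- intros h [Ha _]. rewrite <- Ha, comp_assoc, H1. apply comp_idl.
Qed.

(** Dually, inverting [q] forces the mediating map to be [b ∘ q'], and [u] is cancelled to check the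
    equation with [a]. *)
Lemma pushout_of_isos (Z X Y Q : C)
    (u : hom Z X) (v : hom Z Y) (p : hom X Q) (q : hom Y Q) :
  p ∘ u = q ∘ v -> is_iso u -> is_iso q -> is_pushout u v p q.
Proof.
intros E Hu (q' & H1 & H2). split; [exact E|].
intros W a b Eab. exists (b ∘ q'). split; [split|].
- apply (iso_epi Hu).
  rewrite <- !comp_assoc, E, (comp_assoc q'), H1, comp_idl. symmetry. exact Eab.
- rewrite <- comp_assoc, H1. apply comp_idr.
- intros h [_ Hb]. rewrite <- Hb, <- comp_assoc, H2. apply comp_idr.
Qed.

End Isomorphisms.

Lemma fmap_iso (C D : category) (G : functor C D) (A B : C) (f : hom A B) :
  is_iso f -> is_iso (fmap G f).
Proof.
intros (g & H1 & H2). exists (fmap G g).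
split; rewrite <- fmap_comp, ?H1, ?H2; apply fmap_id.
Qed.

(** * Transport of epi and mono components along isomorphisms *)

Section NaturalTransformations.
Variables (C : category) (G : functor C C).

(** Naturality at [i] exhibits [u B] as [u A] composed with isomorphisms on both sides. *)
Lemma component_epi_iso (u : nat_trans (functor_id C) G) (A B : C) :
  isomorphic A B -> epi (u A) -> epi (u B).
Proof.
intros (i & j & Hji & Hij) Hu.
assert (E : u B = fmap G i ∘ u A ∘ j).
{ rewrite <- (naturality u i). simpl.
  rewrite <- comp_assoc, Hij, comp_idr. reflexivity. }
rewrite E. apply epi_comp; [apply epi_comp; [|exact Hu]|]; apply iso_epi.
- apply fmap_iso. exists j. split; assumption.
- exists i. split; assumption.
Qed.

Lemma component_mono_iso (u : nat_trans G (functor_id C)) (A B : C) :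
  isomorphic A B -> mono (u A) -> mono (u B).
Proof.
intros (i & j & Hji & Hij) Hu.
assert (E : u B = i ∘ (u A ∘ fmap G j)).
{ rewrite (naturality u j). simpl.
  rewrite comp_assoc, Hij, comp_idl. reflexivity. }
rewrite E. apply mono_comp; [|apply mono_comp; [exact Hu|]]; apply iso_mono.
- exists j. split; assumption.
- apply fmap_iso. exists i. split; assumption.
Qed.

End NaturalTransformations.

(** * Full subcategories: equality of objects, and restriction of universal properties *)

Section FullSubcategories.
Variables (C : category) (P : full_subcat C).

Lemma full_sub_eq (x y : full_sub P) : proj1_sig x = proj1_sig y -> x = y.
Proof.
destruct x as [a p], y as [b q]; simpl. intros E. destruct E.
f_equal. apply proof_irrelevance.
Qed.

(** Serves to replace one membership proof by another in a component of a unit or counit. Since [Q]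
    depends on the underlying object only, no transport appears in the equation. *)
Lemma full_sub_proof_irrelevance (Q : C -> Type)
    (u : forall x : full_sub P, Q (proj1_sig x))
    (x : full_sub P) (p : P (proj1_sig x)) :
  u (exist P (proj1_sig x) p) = u x.
Proof.
destruct x as [a q]; simpl in *. rewrite (proof_irrelevance _ p q). reflexivity.
Qed.

(** The left side is formed in [full_sub P] and the right side in [C]; their types are convertible.
    This moves comparisons of strict identities down to [C]. *)
Lemma hom_of_eq_full_sub (x y : full_sub P) (e : x = y)
    (e' : proj1_sig x = proj1_sig y) : hom_of_eq e = hom_of_eq e'.
Proof.
destruct e. rewrite (proof_irrelevance _ e' eq_refl). reflexivity.
Qed.

(** The two sides are convertible; the lemma only retypes the isomorphism as one of [C]. *)
Lemma isomorphic_full_sub (x y : full_sub P) :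
  isomorphic x y -> isomorphic (inclusion P x) (inclusion P y).
Proof. intros H. exact H. Qed.

(** Test objects of the subcategory are test objects of [C] with the same morphisms; this also gives
    the next three lemmas. *)
Lemma full_sub_mono (x y : full_sub P) (m : hom x y) :
  mono (C := C) (A := proj1_sig x) (B := proj1_sig y) m -> mono m.
Proof. intros Hm X. exact (Hm (proj1_sig X)). Qed.

Lemma full_sub_epi (x y : full_sub P) (e : hom x y) :
  epi (C := C) (A := proj1_sig x) (B := proj1_sig y) e -> epi e.
Proof. intros He X. exact (He (proj1_sig X)). Qed.

Lemma full_sub_pullback (w x y z : full_sub P)
    (p : hom w x) (q : hom w y) (u : hom x z) (v : hom y z) :
  is_pullback (C := C) (P := proj1_sig w) (X := proj1_sig x)
    (Y := proj1_sig y) (Z := proj1_sig z) p q u v ->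
  is_pullback p q u v.
Proof. intros [E U]. split; [exact E|]. intros W. exact (U (proj1_sig W)). Qed.

Lemma full_sub_pushout (w x y z : full_sub P)
    (u : hom w x) (v : hom w y) (p : hom x z) (q : hom y z) :
  is_pushout (C := C) (Z := proj1_sig w) (X := proj1_sig x)
    (Y := proj1_sig y) (Q := proj1_sig z) u v p q ->
  is_pushout u v p q.
Proof. intros [E U]. split; [exact E|]. intros W. exact (U (proj1_sig W)). Qed.

End FullSubcategories.

(** * The subcategories [T_ring], [F_ring] and [C_TF] of a near-torsion theory *)

Section NearTorsionTheory.
Variables (C : category) (T F : full_subcat C) (N : near_torsion_theory T F).

Lemma T_tt_t (A : C) : T (tt_t N A).
Proof. exact (proj2_sig (coreflector N A)). Qed.

Lemma F_tt_f (A : C) : F (tt_f N A).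
Proof. exact (proj2_sig (reflector N A)). Qed.

(** By a triangle identity [ε] at [A] is a retraction of the unit, which is an identity and hence
    invertible. *)
Lemma eps_iso (A : C) : T A -> is_iso (tt_eps N A).
Proof.
intros HA. pose (x := exist T A HA : full_sub T).
apply (retraction_of_iso (s := adj_unit (coreflection N) x));
  [|exact (adj_triangle_l (coreflection N) x)].
destruct (coreflection_unit N) as [e He]. rewrite He.
exact (hom_of_eq_iso (e x)).
Qed.

Lemma eta_iso (A : C) : F A -> is_iso (tt_eta N A).
Proof.
intros HA. pose (x := exist F A HA : full_sub F).
apply (section_of_iso (r := adj_counit (reflection N) x));
  [|exact (adj_triangle_r (reflection N) x)].
destruct (reflection_counit N) as [e He]. rewrite He.
exact (hom_of_eq_iso (e x)).
Qed.

Lemma T_ring_replete : replete (T_ring N).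
Proof.
intros A B i [HT He]. split.
- exact (T_replete N i HT).
- exact (component_epi_iso i He).
Qed.

Lemma F_ring_replete : replete (F_ring N).
Proof.
intros A B i [HF Hm]. split.
- exact (F_replete N i HF).
- exact (component_mono_iso i Hm).
Qed.

Lemma pullback_square_comm (B : C) :
  tt_eta N B ∘ tt_eps N B = tt_eps N (tt_f N B) ∘ fmap (tt_t N) (tt_eta N B).
Proof. symmetry. exact (naturality (tt_eps N) (tt_eta N B)). Qed.

Lemma pushout_square_comm (B : C) :
  tt_eta N B ∘ tt_eps N B = fmap (tt_f N) (tt_eps N B) ∘ tt_eta N (tt_t N B).
Proof. exact (naturality (tt_eta N) (tt_eps N B)). Qed.

Lemma T_F_ring (A : C) : T A -> F A -> F_ring N A.
Proof. intros HT HF. split; [exact HF | exact (iso_mono (eps_iso HT))]. Qed.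

Lemma F_T_ring (A : C) : T A -> F A -> T_ring N A.
Proof. intros HT HF. split; [exact HT | exact (iso_epi (eta_iso HF))]. Qed.

(** The object [t(A)] is isomorphic to [A], and [f(A)] lies in both [T] and [F]. The invertible
    sides are [ε] at [A] and at [f(A)] for the pullback, and [ε] at [A] and its image under [f] for
    the pushout. *)
Lemma T_ring_C_TF (A : C) : T_ring N A -> C_TF N A.
Proof.
intros HA. pose proof (proj1 HA) as HT.
pose proof (eps_iso HT) as Hi.
assert (HfT : T (tt_f N A)) by exact (reflector_T N HT).
split; [|split; [|split]].
- exact (T_ring_replete (isomorphic_sym (is_iso_isomorphic Hi)) HA).
- exact (T_F_ring HfT (F_tt_f A)).
- exact (pullback_of_isos (pullback_square_comm A) Hi (eps_iso HfT)).
- exact (pushout_of_isos (pushout_square_comm A) Hi (fmap_iso (tt_f N) Hi)).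
Qed.

Lemma F_ring_C_TF (A : C) : F_ring N A -> C_TF N A.
Proof.
intros HA. pose proof (proj1 HA) as HF.
pose proof (eta_iso HF) as Hi.
assert (HtF : F (tt_t N A)) by exact (coreflector_F N HF).
split; [|split; [|split]].
- exact (F_T_ring (T_tt_t A) HtF).
- exact (F_ring_replete (is_iso_isomorphic Hi) HA).
(* The invertible sides are now the other pair, [t(η)] and [η] here, [η] at [t(A)] and at [A] below;
   hence the squares are transposed. *)
- exact (is_pullback_sym (pullback_of_isos (eq_sym (pullback_square_comm A))
    (fmap_iso (tt_t N) Hi) Hi)).
- exact (is_pushout_sym (pushout_of_isos (eq_sym (pushout_square_comm A))
    (eta_iso HtF) Hi)).
Qed.

(** For the converse, [C_TF] puts [t(A)] in [T_ring], and the isomorphism [ε] at [A] carries this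
    over to [A]. *)
Lemma T_ring_iff (A : C) : T_ring N A <-> T A /\ C_TF N A.
Proof.
split.
- intros HA. split; [exact (proj1 HA) | exact (T_ring_C_TF HA)].
- intros [HT [Ht _]].
  exact (T_ring_replete (is_iso_isomorphic (eps_iso HT)) Ht).
Qed.

Lemma F_ring_iff (A : C) : F_ring N A <-> F A /\ C_TF N A.
Proof.
split.
- intros HA. split; [exact (proj1 HA) | exact (F_ring_C_TF HA)].
- intros [HF [_ [Hf _]]].
  exact (F_ring_replete (isomorphic_sym (is_iso_isomorphic (eta_iso HF))) Hf).
Qed.

Lemma C_TF_iff (B : C) : C_TF N B <-> TT1 N B /\ TT2 N B.
Proof.
split.
- intros ([_ He] & [_ Hm] & Hpb & Hpo). split; split; assumption.
- intros [[Hm Hpb] [He Hpo]].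
  exact (conj (conj (T_tt_t B) He) (conj (conj (F_tt_f B) Hm) (conj Hpb Hpo))).
Qed.

(** * Restriction of both adjunctions to [C_TF] *)

Let D : category := full_sub (C_TF N).
Let T' : full_subcat D := sub_in (C_TF N) (T_ring N).
Let F' : full_subcat D := sub_in (C_TF N) (F_ring N).

(** Repacks an object of the nested subcategory so that the data of [N] can be evaluated at it; the
    underlying object, hence the hom types, stay the same. *)
Definition T_ring_in_T (x : full_sub T') : full_sub T :=
  exist T (proj1_sig (proj1_sig x)) (proj1 (proj2_sig x)).

Definition F_ring_in_F (x : full_sub F') : full_sub F :=
  exist F (proj1_sig (proj1_sig x)) (proj1 (proj2_sig x)).

(** The proof [H] that [t(B)] is in [T_ring] serves twice: for membership in [C_TF], and then for
    membership in [T']. *)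
Definition t_ring_obj (B : D) : full_sub T' :=
  let H := proj1 (proj2_sig B) in
  exist T' (exist (C_TF N) (tt_t N (proj1_sig B)) (T_ring_C_TF H)) H.

Definition f_ring_obj (B : D) : full_sub F' :=
  let H := proj1 (proj2 (proj2_sig B)) in
  exist F' (exist (C_TF N) (tt_f N (proj1_sig B)) (F_ring_C_TF H)) H.

Definition t_ring : functor D (full_sub T') :=
  @Functor D (full_sub T') t_ring_obj
    (fun A B (g : hom A B) =>
      fmap (tt_t N) (g : hom (proj1_sig A) (proj1_sig B)))
    (fun A => fmap_id (tt_t N) (proj1_sig A))
    (fun A B E g h => fmap_comp (tt_t N) g h).

Definition f_ring : functor D (full_sub F') :=
  @Functor D (full_sub F') f_ring_obj
    (fun A B (g : hom A B) =>
      fmap (tt_f N) (g : hom (proj1_sig A) (proj1_sig B)))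
    (fun A => fmap_id (tt_f N) (proj1_sig A))
    (fun A B E g h => fmap_comp (tt_f N) g h).

Definition t_ring_unit :
    nat_trans (functor_id (full_sub T')) (functor_comp t_ring (inclusion T')) :=
  @NatTrans _ _ (functor_id (full_sub T')) (functor_comp t_ring (inclusion T'))
    (fun x => adj_unit (coreflection N) (T_ring_in_T x))
    (fun x y g => @naturality _ _ _ _ (adj_unit (coreflection N))
      (T_ring_in_T x) (T_ring_in_T y) g).

Definition t_ring_counit :
    nat_trans (functor_comp (inclusion T') t_ring) (functor_id D) :=
  @NatTrans _ _ (functor_comp (inclusion T') t_ring) (functor_id D)
    (fun B => tt_eps N (proj1_sig B))
    (fun A B g => @naturality _ _ _ _ (tt_eps N) (proj1_sig A) (proj1_sig B) g).

(* [T_ring_in_T (t_ring B)] and [coreflector N B] differ only by a proof of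
   membership in [T]. *)
Lemma t_ring_triangle_r (B : D) :
  fmap t_ring (t_ring_counit B) ∘ t_ring_unit (t_ring B) = idm (t_ring B).
Proof.
refine (eq_trans _ (adj_triangle_r (coreflection N) (proj1_sig B))).
apply (f_equal (comp (c := C) (fmap (tt_t N) (tt_eps N (proj1_sig B))))).
exact (full_sub_proof_irrelevance (P := T) (Q := fun a => hom a (tt_t N a))
  (fun x => adj_unit (coreflection N) x)
  (x := coreflector N (proj1_sig B)) _).
Qed.

Definition t_ring_adjunction : adjunction (inclusion T') t_ring :=
  @Adjunction _ _ (inclusion T') t_ring t_ring_unit t_ring_counit
    (fun x => adj_triangle_l (coreflection N) (T_ring_in_T x))
    t_ring_triangle_r.

Definition f_ring_unit :
    nat_trans (functor_id D) (functor_comp (inclusion F') f_ring) :=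
  @NatTrans _ _ (functor_id D) (functor_comp (inclusion F') f_ring)
    (fun B => tt_eta N (proj1_sig B))
    (fun A B g => @naturality _ _ _ _ (tt_eta N) (proj1_sig A) (proj1_sig B) g).

Definition f_ring_counit :
    nat_trans (functor_comp f_ring (inclusion F')) (functor_id (full_sub F')) :=
  @NatTrans _ _ (functor_comp f_ring (inclusion F')) (functor_id (full_sub F'))
    (fun x => adj_counit (reflection N) (F_ring_in_F x))
    (fun x y g => @naturality _ _ _ _ (adj_counit (reflection N))
      (F_ring_in_F x) (F_ring_in_F y) g).

(** The triangle identity of [N] at the underlying object, once the membership proof in the repacked
    [reflector N B] is exchanged. *)
Lemma f_ring_triangle_l (B : D) :
  f_ring_counit (f_ring B) ∘ fmap f_ring (f_ring_unit B) = idm (f_ring B).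
Proof.
refine (eq_trans _ (adj_triangle_l (reflection N) (proj1_sig B))).
apply (f_equal (fun g =>
  comp (c := C) g (fmap (tt_f N) (tt_eta N (proj1_sig B))))).
exact (full_sub_proof_irrelevance (P := F) (Q := fun a => hom (tt_f N a) a)
  (fun x => adj_counit (reflection N) x)
  (x := reflector N (proj1_sig B)) _).
Qed.

Definition f_ring_adjunction : adjunction f_ring (inclusion F') :=
  @Adjunction _ _ f_ring (inclusion F') f_ring_unit f_ring_counit
    f_ring_triangle_l
    (fun x => adj_triangle_r (reflection N) (F_ring_in_F x)).

(* Proof irrelevance turns an equality of underlying objects of [C] into one of
   objects of the nested full subcategories. *)
Lemma ring_obj_eq (P : full_subcat D) (x y : full_sub P) :
  proj1_sig (proj1_sig x) = proj1_sig (proj1_sig y) -> x = y.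
Proof. intros e. apply full_sub_eq, full_sub_eq, e. Qed.

Lemma hom_of_eq_ring (P : full_subcat D) (x y : full_sub P) (e : x = y)
    (e' : proj1_sig (proj1_sig x) = proj1_sig (proj1_sig y)) :
  hom_of_eq e = hom_of_eq e'.
Proof.
rewrite (hom_of_eq_full_sub e (f_equal (fun z => proj1_sig z) e)).
exact (hom_of_eq_full_sub _ e').
Qed.

(** * Strictness of the restricted adjunctions *)

Lemma t_ring_left_inverse :
  functor_eq (functor_comp t_ring (inclusion T')) (functor_id (full_sub T')).
Proof.
destruct (coreflector_left_inverse N) as [e He].
(* The equality supplied by [N] is projected to [C], the common ground on which the [hom_of_eq] of
   both full subcategories are compared. *)
pose (e' := (fun x => f_equal (fun z => proj1_sig z) (e (T_ring_in_T x))) :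
  forall x : full_sub T',
  proj1_sig (proj1_sig (t_ring (proj1_sig x))) = proj1_sig (proj1_sig x)).
exists (fun x => ring_obj_eq (P := T') (e' x)). intros x y g.
rewrite (hom_of_eq_ring _ (e' x)), (hom_of_eq_ring _ (e' y)).
pose proof (He (T_ring_in_T x) (T_ring_in_T y) g) as E.
rewrite (hom_of_eq_full_sub (e (T_ring_in_T x)) (e' x)),
  (hom_of_eq_full_sub (e (T_ring_in_T y)) (e' y)) in E.
exact E.
Qed.

Lemma f_ring_left_inverse :
  functor_eq (functor_comp f_ring (inclusion F')) (functor_id (full_sub F')).
Proof.
destruct (reflector_left_inverse N) as [e He].
pose (e' := (fun x => f_equal (fun z => proj1_sig z) (e (F_ring_in_F x))) :
  forall x : full_sub F',
  proj1_sig (proj1_sig (f_ring (proj1_sig x))) = proj1_sig (proj1_sig x)).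
exists (fun x => ring_obj_eq (P := F') (e' x)). intros x y g.
rewrite (hom_of_eq_ring _ (e' x)), (hom_of_eq_ring _ (e' y)).
pose proof (He (F_ring_in_F x) (F_ring_in_F y) g) as E.
rewrite (hom_of_eq_full_sub (e (F_ring_in_F x)) (e' x)),
  (hom_of_eq_full_sub (e (F_ring_in_F y)) (e' y)) in E.
exact E.
Qed.

Lemma t_ring_unit_identity : is_identity t_ring_unit.
Proof.
destruct (coreflection_unit N) as [e He].
pose (e' := (fun x => f_equal (fun z => proj1_sig z) (e (T_ring_in_T x))) :
  forall x : full_sub T',
  proj1_sig (proj1_sig x) = proj1_sig (proj1_sig (t_ring (proj1_sig x)))).
exists (fun x => ring_obj_eq (P := T') (e' x)). intros x.
rewrite (hom_of_eq_ring _ (e' x)).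
refine (eq_trans (He (T_ring_in_T x)) _).
exact (hom_of_eq_full_sub (e (T_ring_in_T x)) (e' x)).
Qed.

Lemma f_ring_counit_identity : is_identity f_ring_counit.
Proof.
destruct (reflection_counit N) as [e He].
pose (e' := (fun x => f_equal (fun z => proj1_sig z) (e (F_ring_in_F x))) :
  forall x : full_sub F',
  proj1_sig (proj1_sig (f_ring (proj1_sig x))) = proj1_sig (proj1_sig x)).
exists (fun x => ring_obj_eq (P := F') (e' x)). intros x.
rewrite (hom_of_eq_ring _ (e' x)).
refine (eq_trans (He (F_ring_in_F x)) _).
exact (hom_of_eq_full_sub (e (F_ring_in_F x)) (e' x)).
Qed.

(** * The torsion theory in [C_TF] *)

Definition ring_near_torsion_theory : near_torsion_theory T' F' :=
  @NearTorsionTheory D T' F'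
    (fun A B i => T_ring_replete (isomorphic_full_sub i))
    (fun A B i => F_ring_replete (isomorphic_full_sub i))
    t_ring t_ring_adjunction t_ring_left_inverse t_ring_unit_identity
    f_ring f_ring_adjunction f_ring_left_inverse f_ring_counit_identity
    (* For [A] in [F_ring], the object [t(A)] lies in [T] and [F], so [ε] is invertible there;
       dually for [f] on [T_ring]. *)
    (fun A HA => T_F_ring (T_tt_t (proj1_sig A)) (coreflector_F N (proj1 HA)))
    (fun A HA => F_T_ring (reflector_T N (proj1 HA)) (F_tt_f (proj1_sig A))).

(** On underlying objects the restricted [t], [f], [ε], [η] are convertible to those of [N], so the
    torsion conditions known in [C] pass to the full subcategory. *)
Lemma ring_torsion_theory : torsion_theory T' F'.
Proof.
exists ring_near_torsion_theory. intros B.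
destruct (proj1 (C_TF_iff (proj1_sig B)) (proj2_sig B))
  as [[Hm Hpb] [He Hpo]].
split; split.
- apply full_sub_mono. exact Hm.
- apply full_sub_pullback. exact Hpb.
- apply full_sub_epi. exact He.
- apply full_sub_pushout. exact Hpo.
Qed.

End NearTorsionTheory.

Theorem theorem2p7 (C : category) (T F : full_subcat C)
    (N : near_torsion_theory T F) :
  torsion_theory
    (sub_in (C_TF N) (T_ring N)) (sub_in (C_TF N) (F_ring N)) /\
  (forall A : C, T_ring N A <-> T A /\ C_TF N A) /\
  (forall A : C, F_ring N A <-> F A /\ C_TF N A) /\
  is_largest
    (fun C' : full_subcat C => forall B : C, C' B -> TT1 N B /\ TT2 N B)
    (C_TF N).
Proof.
split; [|split; [|split]].
- apply ring_torsion_theory.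
- apply T_ring_iff.
- apply F_ring_iff.
- split.
  + intros B. apply C_TF_iff.
  + intros P' HP' B HB. apply C_TF_iff, HP', HB.
Qed.
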